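(* Let $\mathcal T$ be a Galton-Watson tree whose offspring distribution has finite mean $\lambda>1$, and consider the parking process on $\mathcal T$ with i.i.d. car arrivals distributed as $\eta(\alpha)$, where $(\eta(\alpha))$ is a stochastically increasing family of nonnegative integer-valued random variables with $E\eta(\alpha)=\alpha$. Let $X_n$ be the number of cars that arrive to the root $\rho$ up to time $n$, let $\tau$ be the time that the first car arrives to $\rho$, and let $\alpha_c$ be the critical threshold. Then $$\lim_{n\to\infty}\frac{EX_n}{\lambda^n}=\frac{\lambda}{\lambda-1}\left(\alpha-E\lambda^{-\tau}\right).$$ Moreover, $$\alpha_c=\sup\{\alpha\colon E\lambda^{-\tau}=\alpha\}.$$
   Context: Parking process: on a tree $\mathcal T$ with root $\rho$, each vertex has one parking spot. Initially (time $0$) $\eta_v$ cars arrive to each vertex $v$. Cars move towards the root in discrete time, one edge per time step. When a car arrives at an available spot it parks there and the spot becomes unavailable; if several cars arrive at the same available spot simultaneously, one chosen uniformly at random parks there and the others continue towards the root. (This applies also to the cars arriving initially at a vertex.) $X_n$ is the number of cars that arrive to $\rho$ up to time $n$, with $X_0=\eta_\rho$; $X=\lim_n X_n\in\{0,1,\dots\}\cup\{\infty\}$ is the total number of cars that arrive to $\rho$. $\tau=\inf\{n\ge0: X_n>0\}$, with $\tau=\infty$ if no car ever arrives, and $\lambda^{-\infty}=0$. The law of $\tau$ depends on $\alpha$. Recursion: if $Z$ denotes the number of children of $\rho$, then $X_{n+1}=\eta_\rho+\sum_{i=1}^Z (X_n^{(i)}-1)^+$, where the $X_n^{(i)}$ are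 i.i.d. copies of $X_n$, independent of $Z$ and $\eta_\rho$, and $x^+=\max(0,x)$. Setting: $\mathcal T$ is a Galton-Watson tree with nonnegative integer-valued offspring variable $Z$, $EZ=\lambda\in(1,\infty)$. The $\eta_v$ are i.i.d. with law $\eta(\alpha)$, independent of $\mathcal T$. The family $(\eta(\alpha))$ is indexed by its mean $\alpha=E\eta(\alpha)$, with $\alpha$ ranging over an interval in $[0,\infty)$ containing $(0,1)$ (the supremum is over $\alpha$ in this interval). It is stochastically increasing: $P(\eta(\alpha)\ge x)\le P(\eta(\alpha')\ge x)$ for all $x\ge0$ and $\alpha\le\alpha'$. Critical threshold: $\alpha_c\in(0,1)$ is the number such that $EX<\infty$ for $\alpha<\alpha_c$, while for $\alpha>\alpha_c$, conditionally on non-extinction of $\mathcal T$, $X=\infty$ almost surely (its existence is a theorem of Goldschmidt and Przykucki and is part of the standing assumptions). *)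

(* Defs.v *)
From HB Require Import structures.
From mathcomp Require Import all_boot all_order all_algebra.
From mathcomp Require Import all_classical all_reals all_analysis.

Set Implicit Arguments.
Unset Strict Implicit.
Unset Printing Implicit Defensive.

Import Order.TTheory GRing.Theory Num.Theory.
Import numFieldNormedType.Exports.

Local Open Scope classical_set_scope.
Local Open Scope ring_scope.

(* Vertices carry Ulam-Harris labels: [::] is the root and the children of v
   are the labels rcons v i with i < child v. *)
Definition gw_tree (child : seq nat -> nat) : set (seq nat) :=
  [set v | forall u i, prefix (rcons u i) v -> (i < child u)%N].

Definition non_extinct (child : seq nat -> nat) : Prop :=
  forall n, exists2 v, gw_tree child v & size v = n.

(* park child eta n v = (a, free): a is the number of cars arriving at v at
   time exactly n, and free tells whether the spot of v is still available just
   before they arrive. If free and a > 0, exactly one of these cars parks, so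
   that a - free (truncated) cars leave for the parent and arrive there at
   time n + 1. Which of the tied cars parks has no influence on these counts,
   hence the uniform tie-breaking variables do not appear. Only vertices of
   gw_tree child influence the values at the vertices of gw_tree child. *)
Fixpoint park (child eta : seq nat -> nat) (n : nat) (v : seq nat)
    : nat * bool :=
  match n with
  | 0 => (eta v, true)
  | m.+1 =>
      ((\sum_(i < child v)
          ((park child eta m (rcons v i)).1 -
           (park child eta m (rcons v i)).2))%N,
       (park child eta m v).2 && ((park child eta m v).1 == 0%N))
  end.

Definition root_arrivals (child eta : seq nat -> nat) (n : nat) : nat :=
  (\sum_(k < n.+1) (park child eta k [::]).1)%N.

Definition total_root_arrivals (R : realType) (child eta : seq nat -> nat)
    : \bar R :=
  limn (fun n => ((root_arrivals child eta n)%:R)%:E).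

(* Infimum in the extended reals: it is +oo when no car ever arrives. *)
Definition first_arrival (R : realType) (child eta : seq nat -> nat)
    : \bar R :=
  ereal_inf [set (n%:R)%:E | n in [set n | (0 < root_arrivals child eta n)%N]].

(* lambda^(-t) for a time t in [0, +oo], with lambda^(-oo) = 0. *)
Definition discount (R : realType) (lambda : R) (t : \bar R) : R :=
  if t is r%:E then lambda `^ (- r) else 0.

Definition mutually_independent (d : measure_display) (T : measurableType d)
    (R : realType) (P : probability T R) (I : eqType)
    (X : I -> {RV P >-> nat}) : Prop :=
  forall (s : seq I) (A : I -> set nat), uniq s ->
    P (\big[setI/setT]_(i <- s) (X i @^-1` A i)) =
    (\prod_(i <- s) P (X i @^-1` A i))%E.

(* child v and eta v are sampled for every label v, whether or not v belongs
   to the tree; all of them are independent, so that in particular the eta v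
   are independent of the tree. *)
Definition is_parking_model (R : realType) (offspring arrival : probability nat R)
    (d : measure_display) (T : measurableType d) (P : probability T R)
    (child eta : seq nat -> {RV P >-> nat}) : Prop :=
  [/\ forall v A, distribution P (child v) A = offspring A,
      forall v A, distribution P (eta v) A = arrival A &
      mutually_independent
        (fun i : (seq nat + seq nat)%type =>
           match i with inl v => child v | inr v => eta v end)].

Definition mean (R : realType) (mu : probability nat R) : \bar R :=
  ('E_mu[fun k : nat => k%:R])%E.

Definition stochastically_increasing (R : realType) (J : interval R)
    (arrival : R -> probability nat R) : Prop :=
  forall a b, a \in J -> b \in J -> a <= b ->
  forall x : R, 0 <= x ->
    (arrival a [set k : nat | (x <= k%:R)%R] <=
     arrival b [set k : nat | (x <= k%:R)%R])%E.

Definition is_critical_threshold (R : realType) (J : interval R)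
    (d : R -> measure_display) (T : forall a : R, measurableType (d a))
    (P : forall a : R, probability (T a) R)
    (child eta : forall a : R, seq nat -> {RV (P a) >-> nat})
    (alpha_c : R) : Prop :=
  [/\ 0 < alpha_c < 1,
      forall a, a \in J -> a < alpha_c ->
        (\int[P a]_w total_root_arrivals R (child a ^~ w) (eta a ^~ w) < +oo)%E
    & forall a, a \in J -> alpha_c < a ->
        {ae P a, forall w, non_extinct (child a ^~ w) ->
          total_root_arrivals R (child a ^~ w) (eta a ^~ w) = +oo%E}].

(* Main.v *)
Require Import Defs.
From HB Require Import structures.
From mathcomp Require Import all_boot all_order all_algebra.
From mathcomp Require Import all_classical all_reals all_analysis.
From mathcomp Require Import measurable_realfun ring lra.
Set Implicit Arguments.
Unset Strict Implicit.
Unset Printing Implicit Defensive.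
Import Order.TTheory GRing.Theory Num.Theory.
Import numFieldNormedType.Exports.
Local Open Scope classical_set_scope.
Local Open Scope ring_scope.

(** With [x_n = E X_n] and [q_n = P (X_n > 0) = P (tau <= n)], taking
    expectations in the recursion for [X_n] gives
    [x_(n+1) = a + lambda (x_n - q_n)], so [x_n / lambda^n] is the partial sum
    [a \sum_(k <= n) lambda^-k - \sum_(k < n) lambda^-k q_k]; since
    [\sum_(k >= tau) lambda^-k = lambda / (lambda - 1) lambda^-tau], this
    converges to the announced limit.

    If [E X < oo] the limit is [0], hence [E lambda^-tau = a]: this covers
    [a < alpha_c]. Conversely, put [b = lambda / (lambda - 1)]; the recursion
    and [q_n <= 1] give [x_(n+1) - b >= lambda (x_n - b)], so if the limit is
    [0] then [x_n <= b] for all [n] and [E X <= b]. This is impossible for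
    [a > alpha_c], because then [X = oo] on the event of non-extinction, which
    has positive probability as [lambda > 1]. *)

(** * Arrivals and extinction as recursions *)

Section deterministic.
Local Open Scope nat_scope.
Variables child eta : seq nat -> nat.

(** Turns the boolean state of the spot into a condition on past arrival counts, so that departures
    can be summed over time. *)
Lemma park_free n v :
  (park child eta n v).2 = (\sum_(k < n) (park child eta k v).1 == 0).
Proof.
elim: n => [|n IHn] /=; first by rewrite big_ord0.
by rewrite IHn big_ord_recr /= addn_eq0.
Qed.

(* Over time the spot retains exactly one car as soon as one arrives. *)
Lemma sum_departures n v :
  \sum_(k < n) ((park child eta k v).1 - (park child eta k v).2) =
  (\sum_(k < n) (park child eta k v).1).-1.
Proof.
elim: n => [|n IHn]; first by rewrite !big_ord0.
rewrite !big_ord_recr /= IHn park_free.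
by case: (\sum_(k < n) _) => [|m]; rewrite ?add0n ?subn1 // subn0 addSn.
Qed.

(** The recursion for [X_n], run at every vertex; on naturals [.-1] is the truncated [(x - 1)^+]. *)
Fixpoint arrivals n v :=
  if n is m.+1 then eta v + \sum_(i < child v) (arrivals m (rcons v i)).-1
  else eta v.

(** Time 0 contributes [eta v]. For later times, exchanging the sums over time and over children
    reduces each child to its total departures, which [sum_departures] evaluates. *)
Lemma arrivalsE n v : \sum_(k < n.+1) (park child eta k v).1 = arrivals n v.
Proof.
elim: n v => [|n IHn] v; first by rewrite big_ord1.
rewrite big_ord_recl /=; congr (_ + _).
rewrite exchange_big /=; apply: eq_bigr => i _.
by rewrite sum_departures IHn.
Qed.

Lemma arrivals_leS n v : arrivals n v <= arrivals n.+1 v.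
Proof. by rewrite -!arrivalsE [leqRHS]big_ord_recr leq_addr. Qed.

(* [dies n v]: v has no descendant n generations below it. *)
Fixpoint dies n v :=
  if n is m.+1 then [forall i : 'I_(child v), dies m (rcons v i)] else false.

Lemma dies_leS n v : dies n v -> dies n.+1 v.
Proof.
elim: n v => [|n IHn] v // /forallP h.
by apply/forallP => i; exact: IHn (h i).
Qed.

(** The path [u] is built by choosing at each generation a child that itself survives; its condition
    is relative to [v], so that the induction can descend to a child. *)
Lemma survivesP n v : ~~ dies n v ->
  exists2 u, (forall w i, prefix (rcons w i) u -> i < child (v ++ w)) &
    size u = n.
Proof.
elim: n v => [|n IHn] v /=.
  by exists [::] => // w i; case: w.
rewrite negb_forall => /existsP[i /IHn[u hu su]].
exists (val i :: u); last by rewrite /= su.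
move=> [|x w] j /=; rewrite ?prefix_cons.
  by rewrite prefix0s andbT => /eqP ->; rewrite cats0.
by case/andP => /eqP -> /hu; rewrite cat_rcons.
Qed.

Lemma survives_non_extinct : (forall n, ~~ dies n [::]) -> non_extinct child.
Proof. by move=> h n; have [u hu <-] := survivesP (h n); exists u. Qed.

End deterministic.

(** Arrivals in the subtree at [v] depend only on the environment below [v], so independence of
    subtrees can be applied to them. *)
Lemma arrivals_cat child eta v n u :
  arrivals (child \o cat v) (eta \o cat v) n u = arrivals child eta n (v ++ u).
Proof.
elim: n u => [|n IHn] u //=; congr (_ + _)%N; apply: eq_bigr => i _.
by rewrite IHn rcons_cat.
Qed.

Lemma dies_cat child v n u : dies (child \o cat v) n u = dies child n (v ++ u).
Proof.
elim: n u => [|n IHn] u //=; apply: eq_forallb => i.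
by rewrite IHn rcons_cat.
Qed.

(** * Independence of the subtrees *)

Section environments.

Definition label : Type := (seq nat + seq nat)%type.

Definition env : Type := label -> nat.

Definition graft (v : seq nat) (j : label) : label :=
  match j with inl u => inl (v ++ u) | inr u => inr (v ++ u) end.

Definition ungraft (v : seq nat) (j : label) : label :=
  match j with
  | inl u => inl (drop (size v) u)
  | inr u => inr (drop (size v) u)
  end.

Lemma graftK v : cancel (graft v) (ungraft v).
Proof. by case=> u /=; rewrite drop_size_cat. Qed.

Definition cylinder (s : seq label) (A : label -> set nat) : set env :=
  [set e | forall j, j \in s -> A j (e j)].

(** The pi-system on which laws of environments are compared. *)
Definition cylinders : set (set env) :=
  [set B | exists2 s : seq label, uniq s & exists A, B = cylinder s A].

Lemma cylinders_setI : setI_closed cylinders.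
Proof.
move=> _ _ [s1 us1 [A1 ->]] [s2 us2 [A2 ->]].
exists (undup (s1 ++ s2)); first exact: undup_uniq.
(* The guards make each coordinate carry the constraints of exactly those lists that contain it. *)
exists (fun j => [set x | (j \in s1 -> A1 j x) /\ (j \in s2 -> A2 j x)]).
apply/seteqP; split => [e [h1 h2] j _|e h].
  by split => [/h1|/h2].
have h' j : (j \in s1) || (j \in s2) ->
    (j \in s1 -> A1 j (e j)) /\ (j \in s2 -> A2 j (e j)).
  by rewrite -mem_cat -mem_undup => /h.
split => j hj; have [] := h' j; rewrite hj ?orbT // => a b; first exact: a.
exact: b.
Qed.

Lemma cylinders_setT : cylinders setT.
Proof.
exists [::] => //; exists (fun _ => setT).
by apply/seteqP; split => // e _ j.
Qed.

End environments.

(** Environments with the product of the discrete sigma-algebras. *)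
Notation envT := (g_sigma_algebraType cylinders).

Lemma cylinder_measurable s A : uniq s -> measurable (cylinder s A : set envT).
Proof. by move=> us; apply: sub_sigma_algebra; exists s => //; exists A. Qed.

Lemma coord_measurable j : measurable_fun setT (fun e : envT => e j).
Proof.
move=> _ A _; rewrite setTI.
rewrite (_ : _ @^-1` A = cylinder [:: j] (fun=> A)).
  exact: cylinder_measurable.
apply/seteqP; split => [e Ae i|e h]; first by rewrite inE => /eqP ->.
by apply: h; rewrite inE.
Qed.

(** * Measurability of counts, tail sums and uniqueness of laws *)

Section nat_measurable.
Context d (T : measurableType d).

Lemma measurable_nat_preimage (f : T -> nat) (A : set nat) :
  measurable_fun setT f -> measurable [set x | A (f x)].
Proof. by move=> mf; rewrite -[X in measurable X]setTI; exact: mf. Qed.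

Lemma measurable_nat_compose (h : nat -> nat) (f : T -> nat) :
  measurable_fun setT f -> measurable_fun setT (h \o f).
Proof. by move=> mf; apply: measurableT_comp. Qed.

(** Splits along the countably many values of [N]; it serves for sums whose number of terms is a
    random offspring number. *)
Lemma measurable_fun_index (f : nat -> T -> nat) (N : T -> nat) :
  measurable_fun setT N -> (forall k, measurable_fun setT (f k)) ->
  measurable_fun setT (fun x => f (N x) x).
Proof.
move=> mN mf _ A _; rewrite setTI.
rewrite (_ : _ @^-1` A = \bigcup_k ((N @^-1` [set k]) `&` (f k @^-1` A))).
  apply: bigcup_measurable => k _; apply: measurableI.
    exact: (measurable_nat_preimage [set k]).
  exact: measurable_nat_preimage.
apply/seteqP; split => [x Ax|x [k _ [/= -> //]]].
by exists (N x).
Qed.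

Lemma measurable_sum_nat (f : nat -> T -> nat) k :
  (forall i, measurable_fun setT (f i)) ->
  measurable_fun setT (fun x => \sum_(i < k) f i x)%N.
Proof.
move=> mf; elim: k => [|k IHk].
  by under eq_fun do rewrite big_ord0; exact: measurable_cst.
by under eq_fun do rewrite big_ord_recr /=; exact: measurable_fun_addn.
Qed.

End nat_measurable.

Lemma arrivals_measurable n v :
  measurable_fun setT (fun e : envT => arrivals (e \o inl) (e \o inr) n v).
Proof.
elim: n v => [|n IHn] v /=; first exact: coord_measurable.
apply: measurable_fun_addn; first exact: coord_measurable.
apply: (@measurable_fun_index _ envT
  (fun k (e : envT) =>
     \sum_(i < k) (arrivals (e \o inl) (e \o inr) n (rcons v i)).-1)%N
  (fun e : envT => e (inl v))); first exact: coord_measurable.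
move=> k; apply: (@measurable_sum_nat _ envT (fun i (e : envT) =>
  (arrivals (e \o inl) (e \o inr) n (rcons v i)).-1)) => i.
exact: (@measurable_nat_compose _ envT predn).
Qed.

Lemma dies_measurable n v :
  measurable [set e : envT | dies (e \o inl) n v].
Proof.
elim: n v => [|n IHn] v /=.
  rewrite (_ : [set _ | _] = set0) //.
  by apply/seteqP; split.
(* The quantifier over children has a random range; fixing the offspring number [k] makes it a
   finite intersection. *)
rewrite (_ : [set _ | _] = \bigcup_k ([set e : envT | e (inl v) = k] `&`
   \bigcap_(i in [set i | i < k]%N)
     [set e : envT | dies (e \o inl) n (rcons v i)])).
  apply: bigcup_measurable => k _; apply: measurableI; last first.
    by apply: fin_bigcap_measurable => [|i _]; [exact: finite_II|exact: IHn].
  exact: (measurable_nat_preimage [set k] (coord_measurable (inl v))).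
apply/seteqP; split => [e /forallP /= h|e [k _ /= [<- h]]].
  by exists (e (inl v)) => //=; split => // i /= ik; have := h (Ordinal ik).
by apply/forallP => i; apply: h => /=.
Qed.

Section tail_sum.
Context d (T : measurableType d) (R : realType) (P : {measure set T -> \bar R}).

Lemma nat_tail_series (n : nat) :
  ((n%:R : R)%:E = \sum_(m <oo) ((m < n)%N%:R : R)%:E)%E.
Proof.
rewrite (nneseries_split 0 n) ?add0n; last by move=> k _; rewrite lee_fin.
rewrite eseries0 ?adde0 => [|m /= nm _]; last by rewrite ltnNge nm.
rewrite sumEFin; congr EFin.
by rewrite big_nat (eq_bigr (fun=> 1)) -?big_nat => [|i /andP[_ ->]//];
  rewrite sumr_const_nat subn0.
Qed.

Lemma nneseries_fin_mull (c : \bar R) (u : nat -> \bar R) :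
  c \is a fin_num -> (forall i, 0 <= u i)%E ->
  (\sum_(i <oo) (c * u i) = c * \sum_(i <oo) u i)%E.
Proof. by move=> cf u0; rewrite -(fineK cf) nneseriesZl. Qed.

(** Writes [h] as the series of the indicators of [m < h] and integrates termwise. Expectations
    thereby reduce to probabilities of events, to which equality of laws and independence apply. *)
Lemma integral_nat_tail (h : T -> nat) : measurable_fun setT h ->
  (\int[P]_w (h w)%:R%:E = \sum_(m <oo) P [set w | (m < h w)%N])%E.
Proof.
move=> mh.
have mS m : measurable [set w | (m < h w)%N].
  exact: (measurable_nat_preimage [set k | (m < k)%N]).
under eq_integral do rewrite nat_tail_series.
have E m : (fun w => ((m < h w)%N%:R : R)%:E) =
    (fun w => ((\1_[set w | (m < h w)%N] w : R)%:E)).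
  by apply/funext => w; rewrite indicE mem_setE.
rewrite integral_nneseries //; last first.
  by move=> m; rewrite E; apply/measurable_EFinP; exact: measurable_indic.
by apply: eq_eseriesr => m _; rewrite E integral_indic // setIT.
Qed.

End tail_sum.

(** Uniqueness of finite measures on a pi-system; the whole space is itself a cylinder, so the
    constant sequence [setT] is an exhaustion. *)
Lemma eq_on_cylinders d (T : measurableType d) (R : realType)
    (mu nu : {measure set T -> \bar R}) (f g : T -> envT) :
  measurable_fun setT f -> measurable_fun setT g -> (mu setT < +oo)%E ->
  (forall s A, uniq s ->
     mu (f @^-1` cylinder s A) = nu (g @^-1` cylinder s A)) ->
  forall B : set envT, measurable B -> mu (f @^-1` B) = nu (g @^-1` B).
Proof.
move=> mf mg muT munu B mB.
apply: (@measure_unique _ R envT cylinders (fun=> setT) erefl cylinders_setI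
  _ _ (pushforward mu f) (pushforward nu g)) => //.
- by move=> _; exact: cylinders_setT.
- by rewrite bigcup_const.
- by move=> _ [s us [A ->]]; exact: munu.
Qed.

(** * Joint law of the subtrees and Wald's identity *)

Section model.
Context (R : realType) d (T : measurableType d) (P : probability T R).
Context (child eta : seq nat -> {RV P >-> nat}).
Context (offspring arrival : probability nat R).
Hypothesis model : is_parking_model offspring arrival child eta.

Let X (j : label) : {RV P >-> nat} :=
  match j with inl v => child v | inr v => eta v end.

Definition field_at (v : seq nat) (w : T) : envT := fun j => X (graft v j) w.

Lemma cylinder_prob (s : seq label) (A : label -> set nat) : uniq s ->
  P [set w | forall j, j \in s -> A j (X j w)] =
  (\prod_(j <- s) P (X j @^-1` A j))%E.
Proof.
case: model => _ _ ind us; rewrite -(ind s A us); congr (P _).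
rewrite -bigcap_seq; apply/seteqP; split => w h j /=; exact: h.
Qed.

Lemma X_graft v j A : P (X (graft v j) @^-1` A) = P (X j @^-1` A).
Proof.
case: model => hc he _.
by case: j => u; [have := hc (v ++ u) A|have := he (v ++ u) A];
  rewrite /distribution /pushforward /= => ->;
  [rewrite -(hc u)|rewrite -(he u)].
Qed.

Lemma X_measurable j A : measurable (X j @^-1` A).
Proof. exact: measurable_nat_preimage. Qed.

Lemma field_at_measurable v : measurable_fun setT (field_at v).
Proof.
have := @measurability _ _ T envT setT (field_at v) cylinders erefl.
apply=> //.
move=> _ [_ [s us [A ->]] <-]; rewrite setTI.
rewrite (_ : _ @^-1` _ =
  \bigcap_(j in [set` s]) (X (graft v j) @^-1` A j)) //.
have [-> |] := eqVneq s [::]; first by rewrite set_nil bigcap_set0.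
move=> _; rewrite bigcap_seq; apply: bigsetI_measurable => j _.
exact: X_measurable.
Qed.

Lemma field_at_measurable_set v (B : set envT) : measurable B ->
  measurable (field_at v @^-1` B).
Proof.
by move=> mB; rewrite -[X in measurable X]setTI; exact: field_at_measurable.
Qed.

(** Grafting is injective, so the product formula applies to the relabelled coordinates, whose
    marginals are unchanged. The value is free of [v]. *)
Lemma cylinder_prob_graft v (s : seq label) (A : label -> set nat) : uniq s ->
  P (field_at v @^-1` cylinder s A) = (\prod_(j <- s) P (X j @^-1` A j))%E.
Proof.
move=> us; have := @cylinder_prob (map (graft v) s) (A \o ungraft v).
rewrite map_inj_uniq; last exact: can_inj (graftK v).
move=> /(_ us); rewrite big_map /=.
under eq_bigr do rewrite graftK X_graft.
move=> <-; congr (P _); apply/seteqP; split => w h j.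
  by case/mapP => k ks ->; rewrite graftK; exact: h.
by move=> js; have := h (graft v j) (map_f _ js); rewrite /= graftK.
Qed.

Lemma same_law v (B : set envT) : measurable B ->
  P (field_at v @^-1` B) = P (field_at [::] @^-1` B).
Proof.
move: B; apply: eq_on_cylinders; [exact: field_at_measurable..| |].
  exact: le_lt_trans (probability_le1 P measurableT) (ltry 1).
move=> s A us; apply: etrans (cylinder_prob_graft v A us) _.
exact/esym/cylinder_prob_graft.
Qed.

(* The label is not a vertex of one of the subtrees at the children 0, ..., k-1
   of the root. *)
Definition off_blocks (k : nat) (j : label) : bool :=
  match j with inl u | inr u => if u is i :: _ then (k <= i)%N else true end.

(* Induction on k: for fixed B_0, ..., B_(k-1) both sides are finite measures in
   B_k, and they agree on cylinders, which move into s. *)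
Lemma block_independence k (B : nat -> set envT) (s : seq label)
    (A : label -> set nat) :
  (forall i, measurable (B i)) -> uniq s -> all (off_blocks k) s ->
  P [set w | (forall i, (i < k)%N -> B i (field_at [:: i] w)) /\
             (forall j, j \in s -> A j (X j w))] =
  ((\prod_(i < k) P (field_at [:: val i] @^-1` B i)) *
   (\prod_(j <- s) P (X j @^-1` A j)))%E.
Proof.
move=> mB; elim: k B mB s A => [|k IHk] B mB s A us hs.
  rewrite big_ord0 mul1e -cylinder_prob //; congr (P _).
  by apply/seteqP; split => w /= => [[]|].
pose D := [set w | (forall i, (i < k)%N -> B i (field_at [:: i] w)) /\
             (forall j, j \in s -> A j (X j w))].
have mD : measurable D.
  rewrite (_ : D =
     (\bigcap_(i in [set i | i < k]%N) (field_at [:: i] @^-1` B i))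
     `&` \bigcap_(j in [set` s]) (X j @^-1` A j)) //.
  apply: measurableI; apply: fin_bigcap_measurable.
  - exact: finite_II.
  - by move=> i _; exact: field_at_measurable_set.
  - exact: finite_seq.
  - by move=> i _; exact: X_measurable.
have PD : P D = ((\prod_(i < k) P (field_at [:: val i] @^-1` B i)) *
   (\prod_(j <- s) P (X j @^-1` A j)))%E.
  apply: IHk => //; apply: (sub_all _ hs) => -[] [|i u] //=; exact: ltnW.
rewrite big_ord_recr /= muleAC -PD.
have fD : P D \is a fin_num by rewrite fin_num_measure.
pose r := NngNum (fine_ge0 (measure_ge0 P D)).
(* As functions of [B k], the two sides are [P] restricted to [D] and [P] scaled by the constant
   [P D]. *)
transitivity (mrestr P mD (field_at [:: k] @^-1` B k)).
  rewrite /mrestr; congr (P _); apply/seteqP; split => w /=.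
    move=> [h1 h2]; split; first exact: h1.
    by split => // i ik; apply: h1; apply: ltnW.
  move=> [h1 [h2 h3]]; split => // i; rewrite ltnS leq_eqVlt => /predU1P[->//|].
  exact: h2.
transitivity (mscale r P (field_at [:: k] @^-1` B k)); last first.
  by rewrite /mscale /= fineK.
move: (B k) (mB k); apply: eq_on_cylinders; [exact: field_at_measurable..| |].
  by rewrite /= /mrestr setTI (le_lt_trans (probability_le1 _ mD)) ?ltry.
move=> t C ut.
rewrite /= /mscale /= fineK // /mrestr cylinder_prob_graft // PD -muleA.
(* [C'] merges the constraints on [s] with those of the cylinder on [t], grafted at child [k]. The
   two sets of labels are disjoint because [s] avoids block [k], so the induction hypothesis covers
   both at once. *)
pose C' j := if j \in s then A j else C (ungraft [:: k] j).
have dis j : j \in t -> graft [:: k] j \notin s.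
  by move=> jt; apply/negP => /(allP hs); case: j jt => u _ /=; rewrite ltnn.
have := IHk B mB (s ++ map (graft [:: k]) t) C'.
rewrite cat_uniq us map_inj_uniq ?ut /=; last exact: can_inj (graftK _).
rewrite andbT all_cat big_cat /= big_map => H.
have -> : (\prod_(j <- s) P (X j @^-1` A j) =
   \prod_(j <- s) P (X j @^-1` C' j))%E.
  by rewrite big_seq [RHS]big_seq; apply: eq_bigr => j js; rewrite /C' js.
have -> : (\prod_(j <- t) P (X j @^-1` C j) =
   \prod_(j <- t) P (X (graft [:: k] j) @^-1` C' (graft [:: k] j)))%E.
  rewrite big_seq [RHS]big_seq; apply: eq_bigr => j jt.
  by rewrite /C' (negbTE (dis j jt)) graftK X_graft.
rewrite -H; last 2 first.
- by apply/hasPn => _ /mapP[j jt ->]; exact: dis.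
- apply/andP; split.
    by apply: (sub_all _ hs) => -[] [|i u] //=; exact: ltnW.
  by apply/allP => _ /mapP[[u|u] jt ->] /=.
congr (P _); apply/seteqP; split => w /=.
  move=> [h1 [h2 h3]]; split => // j; rewrite mem_cat => /orP[js|].
    by rewrite /C' js; exact: h3.
  by case/mapP => l lt ->; rewrite /C' (negbTE (dis _ lt)) graftK; exact: h1.
move=> [h1 h2]; split => [j jt|].
  have := h2 (graft [:: k] j); rewrite mem_cat map_f ?orbT // => /(_ isT).
  by rewrite /C' (negbTE (dis _ jt)) graftK.
split=> // j js; have := h2 j; rewrite mem_cat js => /(_ isT).
by rewrite /C' js.
Qed.

(** The label [inl [::]] lies off every block, so the offspring number of the root is an admissible
    extra coordinate; [same_law] then replaces each subtree by the whole tree. *)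
Lemma root_block_independence k (B : nat -> set envT) (C : set nat) :
  (forall i, measurable (B i)) ->
  P [set w | C (child [::] w) /\
             (forall i, (i < k)%N -> B i (field_at [:: i] w))] =
  (P (child [::] @^-1` C) * \prod_(i < k) P (field_at [::] @^-1` B i))%E.
Proof.
move=> mB.
have := @block_independence k B [:: inl [::]] (fun=> C) mB isT isT.
rewrite big_seq1 muleC.
under eq_bigr do rewrite same_law //.
move=> <-; congr (P _); apply/seteqP; split => w /=.
  by move=> [h1 h2]; split => // j; rewrite inE => /eqP ->.
by move=> [h1 h2]; split => //; apply: (h2 (inl [::])); rewrite inE.
Qed.

(** Uses [i.+1] blocks, all but the last with the trivial constraint [setT], whose factors are 1. *)
Lemma child_field_independence i (B : set envT) (C : set nat) : measurable B ->
  P [set w | C (child [::] w) /\ B (field_at [:: i] w)] =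
  (P (child [::] @^-1` C) * P (field_at [::] @^-1` B))%E.
Proof.
move=> mB; have := @root_block_independence i.+1
  (fun k => if k == i then B else setT) C.
rewrite big_ord_recr /= eqxx big1 => [|k _]; last first.
  by rewrite (ltn_eqF (ltn_ord k)) preimage_setT probability_setT.
rewrite mul1e => <-; last by move=> k; case: eqP.
congr (P _); apply/seteqP; split => w /= -[h1 h2]; split => //.
  by move=> k _; case: eqP => // ->.
by have := h2 i (ltnSn i); rewrite eqxx.
Qed.

Lemma integral_child_eq1 :
  (\int[P]_w (child [::] w)%:R%:E)%E = mean offspring.
Proof.
rewrite /mean unlock integral_nat_tail //.
rewrite (_ : integral _ _ _ = \int[offspring]_k (k%:R)%:E)%E //.
rewrite integral_nat_tail //; case: model => hc _ _.
by apply: eq_eseriesr => m _; exact: (hc [::] [set k | (m < k)%N]).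
Qed.

Lemma integral_eta v :
  (\int[P]_w (eta v w)%:R%:E)%E = mean arrival.
Proof.
rewrite /mean unlock integral_nat_tail //.
rewrite (_ : integral _ _ _ = \int[arrival]_k (k%:R)%:E)%E //.
rewrite integral_nat_tail //; case: model => _ he _.
by apply: eq_eseriesr => m _; exact: (he v [set k | (m < k)%N]).
Qed.

(** The event [i < Z] is independent of the subtree at child [i], so the term of index [i] has mean
    [P(i < Z) E g], and the [P(i < Z)] add up to [E Z]. Independence is available for events, hence
    the integrals are unfolded into tail sums. *)
Lemma wald (g : envT -> nat) : measurable_fun setT g ->
  (\int[P]_w (g (field_at [::] w))%:R%:E < +oo)%E ->
  (\int[P]_w (\sum_(i < child [::] w) g (field_at [:: val i] w))%N%:R%:E =
   mean offspring * \int[P]_w (g (field_at [::] w))%:R%:E)%E.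
Proof.
move=> mg gfin.
have {gfin} gfin : (\int[P]_w (g (field_at [::] w))%:R%:E)%E \is a fin_num.
  by rewrite ge0_fin_numE // integral_ge0 // => w _; rewrite lee_fin.
(* Padding with zeros turns the sum of random length into a series with fixed index set. *)
pose h i w := if (i < child [::] w)%N then g (field_at [:: i] w) else 0%N.
have mgv v : measurable_fun setT (fun w => g (field_at v w)).
  exact: (measurableT_comp mg (field_at_measurable v)).
have mh i : measurable_fun setT (h i).
  apply: (@measurable_fun_index _ _
    (fun z w => if (i < z)%N then g (field_at [:: i] w) else 0%N)) => // z.
  by case: (i < z)%N.
have sumE w :
    (((\sum_(i < child [::] w) g (field_at [:: val i] w))%N%:R : R)%:E =
    \sum_(i <oo) ((h i w)%:R : R)%:E)%E.
  rewrite (nneseries_split 0 (child [::] w)) ?add0n //.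
  rewrite eseries0 ?adde0 => [|m /= nm _]; last by rewrite /h ltnNge nm.
  rewrite sumEFin natr_sum big_mkord; congr EFin.
  by apply: eq_bigr => i _; rewrite /h ltn_ord.
under eq_integral do rewrite sumE.
rewrite integral_nneseries //; last first.
  move=> i; apply/measurable_EFinP.
  exact: (measurableT_comp _ (mh i)).
rewrite -integral_child_eq1 [in RHS]integral_nat_tail //.
rewrite muleC -nneseries_fin_mull //.
apply: eq_eseriesr => i _.
have Pfin : P [set w | (i < child [::] w)%N] \is a fin_num.
  rewrite fin_num_measure //.
  exact: (X_measurable (inl [::]) [set z | (i < z)%N]).
rewrite integral_nat_tail // [in RHS]integral_nat_tail //.
rewrite muleC -nneseries_fin_mull //.
apply: eq_eseriesr => m _.
have mB : measurable ([set e | (m < g e)%N] : set envT).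
  exact: (measurable_nat_preimage [set k | (m < k)%N]).
rewrite -(child_field_independence i [set z | (i < z)%N] mB).
congr (P _); apply/seteqP; split => w; rewrite /= /h; first by case: ifP.
by case => ->.
Qed.

End model.

(** * Expected number of arrivals *)

Section moments.
Context (R : realType) d (T : measurableType d) (P : probability T R).
Context (child eta : seq nat -> {RV P >-> nat}).
Context (offspring arrival : probability nat R) (lambda a : R).
Hypothesis model : is_parking_model offspring arrival child eta.
Hypothesis offspring_mean : mean offspring = lambda%:E.
Hypothesis arrival_mean : mean arrival = a%:E.

Definition cars n v w := arrivals (child ^~ w) (eta ^~ w) n v.

Lemma arrivals_field_at n v u w :
  arrivals (field_at child eta v w \o inl)
    (field_at child eta v w \o inr) n u = cars n (v ++ u) w.
Proof. exact: arrivals_cat. Qed.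

Lemma cars_measurable n v : measurable_fun setT (cars n v).
Proof.
rewrite (_ : cars n v = (fun e : envT => arrivals (e \o inl) (e \o inr) n v) \o
  field_at child eta [::]).
  exact: measurableT_comp (arrivals_measurable n v) (field_at_measurable _ _ _).
by apply/funext => w /=; rewrite arrivals_field_at.
Qed.

Lemma pred_measurable n v : measurable_fun setT (fun w => (cars n v w).-1).
Proof. exact: measurable_nat_compose (cars_measurable n v). Qed.

Lemma natr_measurable (h : T -> nat) : measurable_fun setT h ->
  measurable_fun setT (fun w => (h w)%:R%:E : \bar R).
Proof.
by move=> mh; apply/measurable_EFinP; apply: (measurableT_comp _ mh).
Qed.

Definition expected_cars n : \bar R := (\int[P]_w (cars n [::] w)%:R%:E)%E.

(** Pointwise [x = (x - 1)^+ + 1_{x > 0}]; this is where [q_n] enters. *)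
Lemma expected_cars_pred n :
  expected_cars n = (\int[P]_w (cars n [::] w).-1%:R%:E +
                     P [set w | (0 < cars n [::] w)%N])%E.
Proof.
have mS : measurable [set w | (0 < cars n [::] w)%N].
  exact: (measurable_nat_preimage [set k | (0 < k)%N] (cars_measurable n [::])).
rewrite -[X in P X]setIT -(@integral_indic _ _ _ P setT) //.
rewrite -ge0_integralD //=; last 2 first.
- exact: natr_measurable (pred_measurable n [::]).
- by apply/measurable_EFinP; exact: measurable_indic.
apply: eq_integral => w _.
have -> : \1_[set w | (0 < cars n [::] w)%N] w = (0 < cars n [::] w)%N%:R :> R.
  by rewrite indicE mem_setE.
rewrite -EFinD -natrD; congr (_%:R%:E).
by case: (cars n [::] w) => //= k; rewrite addn1.
Qed.

Lemma expected_cars0 : expected_cars 0 = a%:E.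
Proof. by rewrite -arrival_mean -(integral_eta model [::]). Qed.

Lemma expected_carsS_fin n : (expected_cars n < +oo)%E ->
  expected_cars n.+1 =
    (a%:E + lambda%:E * \int[P]_w (cars n [::] w).-1%:R%:E)%E.
Proof.
move=> fin.
have mg : measurable_fun setT
    (fun e : envT => (arrivals (e \o inl) (e \o inr) n [::]).-1).
  exact: (@measurable_nat_compose _ envT predn) (arrivals_measurable n [::]).
have := wald model mg.
under eq_integral do rewrite arrivals_field_at.
have fin' : (\int[P]_w (cars n [::] w).-1%:R%:E < +oo)%E.
  apply: le_lt_trans fin; apply: ge0_le_integral => //.
  - exact: natr_measurable (pred_measurable n [::]).
  - exact: natr_measurable (cars_measurable n [::]).
  - by move=> w _; rewrite lee_fin ler_nat leq_pred.
move=> /(_ fin'); rewrite offspring_mean => <-.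
rewrite -arrival_mean -(integral_eta model [::]).
have E w : (\sum_(i < child [::] w)
    (arrivals (field_at child eta [:: val i] w \o inl)
    (field_at child eta [:: val i] w \o inr) n [::]).-1)%N =
    (\sum_(i < child [::] w) (cars n [:: val i] w).-1)%N.
  by apply: eq_bigr => i _; rewrite arrivals_field_at.
under [X in (_ + X)%E]eq_integral do rewrite E.
rewrite -ge0_integralD //=.
- by apply: eq_integral => w _; rewrite -EFinD -natrD.
- exact: natr_measurable.
- apply: natr_measurable.
  apply: (@measurable_fun_index _ _
    (fun z w => \sum_(i < z) (cars n [:: val i] w).-1)%N) => // z.
  apply: (@measurable_sum_nat _ _ (fun i w => (cars n [:: i] w).-1)) => i.
  exact: pred_measurable.
Qed.

(** Since [(X_n - 1)^+ <= X_n], finiteness propagates along the recursion. It justifies the later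
    computations in the reals. *)
Lemma expected_cars_fin n : expected_cars n \is a fin_num.
Proof.
have ge0 k : (0 <= expected_cars k)%E.
  by apply: integral_ge0 => w _; rewrite lee_fin.
rewrite ge0_fin_numE //.
elim: n => [|n IHn]; first by rewrite expected_cars0 ltry.
rewrite expected_carsS_fin // lte_add_pinfty ?ltry //.
rewrite lte_mul_pinfty ?lee_fin //.
  by rewrite -lee_fin -offspring_mean /mean unlock; apply: integral_ge0.
by apply: le_lt_trans IHn; rewrite expected_cars_pred leeDl.
Qed.

End moments.

(** * The discounted arrival time as a geometric series *)

Section discount_approximation.
Context (R : realType) (lambda : R) (child eta : seq nat -> nat).
Hypothesis lambda_gt1 : 1 < lambda.

(* Partial sums of [lambda^-tau = (1 - lambda^-1) \sum_(k >= tau) lambda^-k]. *)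
Definition discount_approx n : R :=
  \sum_(k < n)
    (1 - lambda^-1) * lambda ^- k * (0 < arrivals child eta k [::])%N%:R.

Lemma arrivals_mono m n v : (m <= n)%N ->
  (arrivals child eta m v <= arrivals child eta n v)%N.
Proof.
move: m n; apply: (@homo_leq _ (fun n => arrivals child eta n v) leq) => //.
  by move=> ? ? ?; exact: leq_trans.
by move=> k; exact: arrivals_leS.
Qed.

(** The infimum of the empty set is [+oo], which [discount] sends to 0. *)
Lemma discount_none :
  (forall n, arrivals child eta n [::] = 0%N) ->
  discount lambda (first_arrival R child eta) = 0.
Proof.
move=> h; rewrite /first_arrival (_ : [set _ | _ in _] = set0) ?ereal_inf0 //.
by apply/seteqP; split => // _ [n /= + _]; rewrite /root_arrivals arrivalsE h.
Qed.

Lemma discount_first m : (0 < arrivals child eta m [::])%N ->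
  (forall n, (0 < arrivals child eta n [::])%N -> (m <= n)%N) ->
  discount lambda (first_arrival R child eta) = lambda ^- m.
Proof.
move=> m0 mmin; rewrite /first_arrival.
rewrite (_ : ereal_inf _ = m%:R%:E) /=.
  by rewrite powRN powR_mulrn // ltW // (lt_trans ltr01).
apply/eqP; rewrite eq_le; apply/andP; split.
  by apply: ereal_inf_lbound; exists m => //=; rewrite /root_arrivals arrivalsE.
apply: le_ereal_inf_tmp => _ [n /= + <-].
rewrite /root_arrivals arrivalsE lee_fin ler_nat.
exact: mmin.
Qed.

(** If the first arrival is at time [m <= n], the partial sum is [lambda ^- m - lambda ^- n] and the
    upper bound is attained. If [m > n], it is 0 and the gap is [lambda ^- m <= lambda ^- n]. *)
Lemma discount_approxP n :
  discount_approx n <= discount lambda (first_arrival R child eta) <=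
  discount_approx n + lambda ^- n.
Proof.
have l0 : 0 < lambda by exact: lt_trans ltr01 _.
have [[k k0]|none] := pselect (exists k, (0 < arrivals child eta k [::])%N);
  last first.
  have z k : arrivals child eta k [::] = 0%N.
    by apply/eqP; rewrite -leqn0 leqNgt; apply/negP => ?; apply: none; exists k.
  rewrite discount_none // /discount_approx big1 => [|k _]; last first.
    by rewrite z mulr0.
  by rewrite lexx add0r invr_ge0 exprn_ge0 // ltW.
have [m m0 mmin] :=
  ex_minnP (ex_intro (fun j => 0 < arrivals child eta j [::])%N k k0).
rewrite (discount_first m0 mmin).
have pos j : (0 < arrivals child eta j [::])%N = (m <= j)%N.
  by apply/idP/idP => [/mmin //|mj]; apply: leq_trans m0 (arrivals_mono _ mj).
have -> : discount_approx n =
    if (m <= n)%N then lambda ^- m - lambda ^- n else 0.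
  (* Telescoping: each nonzero term is [lambda ^- k - lambda ^- k.+1]. *)
  elim: n => [|n IHn].
    rewrite /discount_approx big_ord0 leqn0.
    by case: eqP => // ->; rewrite subrr.
  rewrite /discount_approx big_ord_recr /= -/(discount_approx n) IHn pos.
  case: (leqP m n) => [mn|nm].
    rewrite leqW // mulr1 exprS; field.
    by rewrite ?gt_eqF ?exprn_gt0 //= gt_eqF.
  rewrite mulr0 addr0; case: (leqP m n.+1) => // mn.
  by rewrite (_ : m = n.+1) ?subrr //; apply/eqP; rewrite eqn_leq mn.
case: leqP => [mn|nm].
  by rewrite subrK lexx andbT gerBl invr_ge0 exprn_ge0 // ltW.
rewrite add0r invr_ge0 (exprn_ge0 _ (ltW l0)) /=.
by rewrite lef_pV2 ?posrE ?exprn_gt0 // ler_weXn2l ?(ltW lambda_gt1) ?(ltnW nm).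
Qed.

Lemma exprV_cvg0 : lambda ^- n @[n --> \oo] --> (0 : R).
Proof.
have l0 : 0 < lambda by exact: lt_trans ltr01 _.
under eq_fun do rewrite -exprVn.
by apply: cvg_expr; rewrite ger0_norm ?invr_ge0 ?ltW // invf_lt1.
Qed.

Lemma discount_approx_cvg :
  discount_approx n @[n --> \oo] -->
  discount lambda (first_arrival R child eta).
Proof.
pose t := discount lambda (first_arrival R child eta).
apply: (@squeeze_cvgr _ _ _ _ (fun n => t - lambda ^- n) (fun=> t)).
- by near=> n; have /andP[-> h] := discount_approxP n; rewrite andbT lerBlDr.
- rewrite -[X in _ --> X]subr0; apply: cvgB; first exact: cvg_cst.
  exact: exprV_cvg0.
- exact: cvg_cst.
Unshelve. all: by end_near.
Qed.

End discount_approximation.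

(** * Limit of the rescaled means and the fixed-point criterion *)

Section limit.
Context (R : realType) d (T : measurableType d) (P : probability T R).
Context (child eta : seq nat -> {RV P >-> nat}).
Context (offspring arrival : probability nat R) (lambda a : R).
Hypothesis lambda_gt1 : 1 < lambda.
Hypothesis model : is_parking_model offspring arrival child eta.
Hypothesis offspring_mean : mean offspring = lambda%:E.
Hypothesis arrival_mean : mean arrival = a%:E.

Let lambda_gt0 : 0 < lambda. Proof. exact: lt_trans ltr01 _. Qed.

Let lambda_neq0 : lambda != 0. Proof. by rewrite gt_eqF. Qed.

Let lambda_sub1 : lambda - 1 != 0. Proof. by rewrite subr_eq0 gt_eqF. Qed.

Let expV_ge0 k : 0 <= lambda ^- k.
Proof. by rewrite invr_ge0 exprn_ge0 // ltW. Qed.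

Let coef_ge0 k : 0 <= (1 - lambda^-1) * lambda ^- k.
Proof. by rewrite mulr_ge0 // subr_ge0 invf_le1 // ltW. Qed.

Notation cars := (cars child eta).
Notation expected_cars := (expected_cars child eta).
Let x n := fine (expected_cars n).
Let q n := fine (P [set w | (0 < cars n [::] w)%N]).

Lemma occupied_measurable n : measurable [set w | (0 < cars n [::] w)%N].
Proof.
exact: (measurable_nat_preimage [set k | (0 < k)%N]
  (cars_measurable child eta n [::])).
Qed.

Let xE n : expected_cars n = (x n)%:E.
Proof.
by rewrite fineK // (expected_cars_fin model offspring_mean arrival_mean).
Qed.

Let qE n : P [set w | (0 < cars n [::] w)%N] = (q n)%:E.
Proof. by rewrite fineK // fin_num_measure //; exact: occupied_measurable. Qed.

Let q_le1 n : 0 <= q n <= 1.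
Proof.
rewrite -!lee_fin -qE measure_ge0 probability_le1 //; exact: occupied_measurable.
Qed.

Lemma expected_carsS n : x n.+1 = a + lambda * (x n - q n).
Proof.
have fin : (expected_cars n < +oo)%E by rewrite xE ltry.
have := expected_carsS_fin model offspring_mean arrival_mean fin.
have := expected_cars_pred child eta n.
rewrite qE !xE => e.
(* A summand of a finite sum is finite, so it can be isolated by a subtraction in the reals. *)
have fint : (\int[P]_w ((cars n [::] w).-1%:R)%:E)%E \is a fin_num.
  by move: e; case: (\int[P]_w _)%E.
move: e; rewrite -(fineK fint) -EFinD -EFinM => -[->].
by rewrite addrK -EFinD => -[->].
Qed.

Lemma scaled_cars n : x n * lambda ^- n =
  a * (\sum_(k < n.+1) lambda ^- k) - \sum_(k < n) lambda ^- k * q k.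
Proof.
elim: n => [|n IHn].
  rewrite big_ord1 big_ord0 !expr0 invr1 !mulr1 subr0 /x.
  by rewrite (expected_cars0 model arrival_mean).
rewrite expected_carsS big_ord_recr [\sum_(k < n.+1) _ * q k]big_ord_recr /=.
rewrite [RHS](_ : _ =
   (a * (\sum_(k < n.+1) lambda ^- k) - \sum_(k < n) lambda ^- k * q k)
   + a * lambda ^- n.+1 - lambda ^- n * q n); last by ring.
by rewrite -IHn exprS; field; rewrite ?lambda_sub1 ?lambda_neq0 ?expf_neq0.
Qed.

Lemma geometric_partial n :
  \sum_(k < n.+1) lambda ^- k = lambda / (lambda - 1) * (1 - lambda ^- n.+1).
Proof.
elim: n => [|n IHn].
  by rewrite big_ord1 expr0 expr1; field; rewrite ?lambda_sub1 ?lambda_neq0.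
rewrite big_ord_recr /= IHn !exprS; field.
by rewrite ?lambda_sub1 ?lambda_neq0 ?expf_neq0.
Qed.

Let disc w := discount lambda (first_arrival R (child ^~ w) (eta ^~ w)).
Let approx n w := discount_approx lambda (child ^~ w) (eta ^~ w) n.

Let occupied_natr_measurable k :
  measurable_fun setT (fun w => (0 < cars k [::] w)%N%:R : R).
Proof.
by apply: (measurableT_comp _ (measurable_nat_compose
  (fun j => (0 < j)%N : nat) (cars_measurable child eta k [::]))).
Qed.

Lemma approx_measurable n : measurable_fun setT (approx n).
Proof.
apply: measurable_sum => k; apply: measurable_funM; first exact: measurable_cst.
exact: occupied_natr_measurable.
Qed.

(** As a pointwise limit of the partial sums, [disc] is measurable without any study of the first
    arrival time itself. *)
Lemma disc_measurable : measurable_fun setT disc.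
Proof.
apply: (measurable_fun_cvg (approx_measurable)) => w _.
exact: discount_approx_cvg.
Qed.

Lemma approx_ge0 n w : 0 <= approx n w.
Proof.
by apply: sumr_ge0 => k _; rewrite mulr_ge0.
Qed.

Lemma expected_approx n :
  (\int[P]_w (approx n w)%:E)%E =
    ((1 - lambda^-1) * \sum_(k < n) lambda ^- k * q k)%:E.
Proof.
pose f k w : \bar R :=
  ((1 - lambda^-1) * lambda ^- k * (0 < cars k [::] w)%N%:R)%:E.
transitivity (\int[P]_w (\sum_(k < n) f k w))%E.
  by apply: eq_integral => w _; rewrite -sumEFin.
rewrite ge0_integral_sum //; last 2 first.
- move=> k; apply/measurable_EFinP; apply: measurable_funM.
    exact: measurable_cst.
  exact: occupied_natr_measurable.
- by move=> k w _; rewrite lee_fin mulr_ge0.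
rewrite mulr_sumr -sumEFin; apply: eq_bigr => k _.
rewrite mulrA EFinM -qE.
rewrite -[X in P X]setIT -(@integral_indic _ _ _ P setT) //; last first.
  exact: occupied_measurable.
rewrite -ge0_integralZl_EFin //; last first.
  apply/measurable_EFinP; apply: measurable_indic.
  exact: occupied_measurable.
apply: eq_integral => w _; rewrite /f EFinM; congr (_ * _%:E)%E.
by rewrite indicE mem_setE.
Qed.

Definition expected_discount : \bar R := ('E_P[disc])%E.

(** Integrates the pointwise bounds of [discount_approxP]; their explicit error [lambda ^- n] avoids
    any exchange of limit and expectation. *)
Lemma expected_discountP n :
  (((1 - lambda^-1) * \sum_(k < n) lambda ^- k * q k)%:E <= expected_discount
  <= ((1 - lambda^-1) * (\sum_(k < n) lambda ^- k * q k) + lambda ^- n)%:E)%E.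
Proof.
have E m w := discount_approxP (child ^~ w) (eta ^~ w) lambda_gt1 m.
have disc0 w : 0 <= disc w.
  by have /andP[h _] := E 0 w; apply: le_trans h; exact: approx_ge0.
rewrite EFinD -expected_approx /expected_discount unlock; apply/andP; split.
  apply: ge0_le_integral => //.
  - by move=> w _; rewrite lee_fin approx_ge0.
  - by apply/measurable_EFinP; exact: approx_measurable.
  - by apply/measurable_EFinP; exact: disc_measurable.
  - by move=> w _; rewrite lee_fin; have /andP[] := E n w.
have -> : ((lambda ^- n)%:E = \int[P]_w (lambda ^- n)%:E)%E.
  by rewrite integral_cst //= probability_setT mule1.
rewrite -ge0_integralD //.
- apply: ge0_le_integral => //.
  - by move=> w _; rewrite lee_fin.
  - by apply/measurable_EFinP; exact: disc_measurable.
  - apply/measurable_EFinP; apply: measurable_funD; last exact: measurable_cst.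
    exact: approx_measurable.
  - by move=> w _; rewrite lee_fin; have /andP[] := E n w.
- by move=> w _; rewrite lee_fin approx_ge0.
- by apply/measurable_EFinP; exact: approx_measurable.
- by move=> w _; rewrite lee_fin.
Qed.

Lemma expected_discount_fin : expected_discount \is a fin_num.
Proof.
have /andP[l u] := expected_discountP 0.
by rewrite fin_numElt (lt_le_trans _ l) ?ltNyr // (le_lt_trans u) ?ltry.
Qed.

Let delta := fine expected_discount.

(** Squeezes the closed form of [scaled_cars]: the geometric sum and the bounds on [delta] both have
    errors of order [lambda ^- n]. *)
Lemma scaled_cars_cvg :
  x n * lambda ^- n @[n --> \oo] --> lambda / (lambda - 1) * (a - delta).
Proof.
have a0 : 0 <= a.
  by rewrite -lee_fin -arrival_mean /mean unlock; apply: integral_ge0.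
have dP n : (1 - lambda^-1) * (\sum_(k < n) lambda ^- k * q k) <= delta <=
   (1 - lambda^-1) * (\sum_(k < n) lambda ^- k * q k) + lambda ^- n.
  have := expected_discountP n.
  by rewrite -(fineK expected_discount_fin) !lee_fin.
have c0 : 0 < lambda / (lambda - 1) by rewrite divr_gt0 // subr_gt0.
have cE : lambda / (lambda - 1) * (1 - lambda^-1) = 1.
  by field; rewrite ?lambda_sub1 ?lambda_neq0 ?expf_neq0.
have geo0 := exprV_cvg0 lambda_gt1.
apply: (@squeeze_cvgr _ _ _ _
  (fun n => lambda / (lambda - 1) * (a - delta - a * lambda ^- n))
  (fun n => lambda / (lambda - 1) * (a - delta + lambda ^- n))).
- near=> n; rewrite scaled_cars geometric_partial.
  set s := \sum_(k < n) _; have /andP[d1 d2] := dP n.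
  (* With [c = lambda / (lambda - 1)], the inverse of [1 - lambda^-1], [h1] and [h2] read
     [s <= c * delta <= s + c * lambda ^- n]. *)
  have h1 := ler_wpM2l (ltW c0) d1; rewrite mulrA cE mul1r -/s in h1.
  have h2 := ler_wpM2l (ltW c0) d2.
  rewrite [leRHS]mulrDr mulrA cE mul1r -/s in h2.
  have le : lambda ^- n.+1 <= lambda ^- n.
    by rewrite lef_pV2 ?posrE ?exprn_gt0 // ler_weXn2l // ltW.
  have h3 := ler_wpM2l (ltW c0) (ler_wpM2l a0 le).
  have h4 := mulr_ge0 (ltW c0) (mulr_ge0 a0 (expV_ge0 n.+1)).
  apply/andP; split; nra.
- have h :
    lambda / (lambda - 1) * (a - delta - a * lambda ^- n) @[n --> \oo] -->
      lambda / (lambda - 1) * (a - delta - a * 0).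
    apply: cvgM; first exact: cvg_cst.
    by apply: cvgB; [exact: cvg_cst|apply: cvgM => //; exact: cvg_cst].
  by rewrite mulr0 subr0 in h.
- have h : lambda / (lambda - 1) * (a - delta + lambda ^- n) @[n --> \oo] -->
      lambda / (lambda - 1) * (a - delta + 0).
    apply: cvgM; first exact: cvg_cst.
    by apply: cvgD => //; exact: cvg_cst.
  by rewrite addr0 in h.
Unshelve. all: by end_near.
Qed.

Lemma subcritical_bound : x n * lambda ^- n @[n --> \oo] --> (0 : R) ->
  forall n, x n <= lambda / (lambda - 1).
Proof.
set b := lambda / (lambda - 1) => cvgx n.
have a0 : 0 <= a.
  by rewrite -lee_fin -arrival_mean /mean unlock; apply: integral_ge0.
pose u k := (x k - b) * lambda ^- k.
have uS k : u k <= u k.+1.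
  have /andP[q0 q1] := q_le1 k.
  have -> : u k = (lambda * (x k - b)) * lambda ^- k.+1.
    by rewrite /u exprS; field; rewrite ?lambda_neq0 ?expf_neq0.
  apply: ler_wpM2r => //; rewrite expected_carsS.
  (* [b] is the fixed point of [y -> lambda * (y - 1)], a lower bound for the recursion because
     [q k <= 1] and [0 <= a]. *)
  have -> : lambda * (x k - b) = lambda * (x k - 1) - b.
    by rewrite /b; field.
  rewrite lerD2r -subr_ge0 (_ : _ - _ = a + lambda * (1 - q k)); last by ring.
  by rewrite addr_ge0 // mulr_ge0 ?subr_ge0 // ltW.
(* A nondecreasing sequence with limit 0 is nonpositive, which forces [x n <= b]. *)
have cu : u k @[k --> \oo] --> 0 - b * 0.
  rewrite (_ : u = fun k => x k * lambda ^- k - b * lambda ^- k); last first.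
    by apply/funext => k; rewrite /u mulrBl.
  apply: cvgB => //; apply: cvgM; first exact: cvg_cst.
  exact: exprV_cvg0.
rewrite mulr0 subr0 in cu.
have : u n <= 0.
  rewrite -(cvg_lim _ cu) //; apply: nondecreasing_cvgn_le.
    by apply/nondecreasing_seqP.
  by apply/cvg_ex; exists 0.
by rewrite /u pmulr_lle0 ?invr_gt0 ?exprn_gt0 // subr_le0.
Qed.

Lemma expected_total :
  (\int[P]_w total_root_arrivals R (child ^~ w) (eta ^~ w) =
  limn expected_cars)%E.
Proof.
pose f n w : \bar R := (cars n [::] w)%:R%:E.
have -> : (fun w => total_root_arrivals R (child ^~ w) (eta ^~ w)) =
    (fun w => limn (f^~ w)).
  apply/funext => w; rewrite /total_root_arrivals; congr (limn _).
  by apply/funext => n; rewrite /root_arrivals arrivalsE.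
rewrite monotone_convergence //.
- by move=> n; apply: natr_measurable; exact: cars_measurable.
- by move=> n w _; rewrite lee_fin.
- by move=> w _ m n mn; rewrite lee_fin ler_nat; exact: arrivals_mono.
Qed.

Lemma expected_cars_nondecreasing : nondecreasing_seq expected_cars.
Proof.
move=> m n mn; apply: ge0_le_integral => //.
- by apply: natr_measurable; exact: cars_measurable.
- by apply: natr_measurable; exact: cars_measurable.
- by move=> w _; rewrite lee_fin ler_nat; exact: arrivals_mono.
Qed.

Lemma expected_cars_is_cvg : cvgn expected_cars.
Proof. exact: ereal_nondecreasing_is_cvgn expected_cars_nondecreasing. Qed.

(** A finite [E X] bounds every [x n], so [x n * lambda ^- n] tends to 0; comparison with
    [scaled_cars_cvg], whose prefactor is nonzero, gives [delta = a]. *)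
Lemma finite_total_fixed_point :
  (\int[P]_w total_root_arrivals R (child ^~ w) (eta ^~ w) < +oo)%E ->
  expected_discount = a%:E.
Proof.
rewrite expected_total => fin.
have le n : (expected_cars n <= limn expected_cars)%E.
  apply: lime_ge; first exact: expected_cars_is_cvg.
  near=> m; apply: expected_cars_nondecreasing; near: m.
  exact: nbhs_infty_ge.
have fin' : limn expected_cars \is a fin_num.
  by rewrite fin_numElt fin andbT (lt_le_trans _ (le 0)) // xE ltNyr.
have xle n : x n <= fine (limn expected_cars).
  by rewrite -lee_fin -xE fineK.
have x0 n : 0 <= x n.
  by rewrite -lee_fin -xE; apply: integral_ge0 => w _; rewrite lee_fin.
have geo0 : fine (limn expected_cars) * lambda ^- n @[n --> \oo] -->
    fine (limn expected_cars) * 0.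
  by apply: cvgM; [exact: cvg_cst|exact: exprV_cvg0].
rewrite mulr0 in geo0.
have c0 : x n * lambda ^- n @[n --> \oo] --> (0 : R).
  apply: (@squeeze_cvgr _ _ _ _ (fun=> 0)
     (fun n => fine (limn expected_cars) * lambda ^- n)) => //;
     last exact: cvg_cst.
  by near=> n; rewrite mulr_ge0 //= ler_wpM2r.
have /eqP : lambda / (lambda - 1) * (a - delta) = 0.
  by rewrite -(cvg_lim _ scaled_cars_cvg) //; exact: cvg_lim c0.
rewrite !mulf_eq0 invr_eq0 (negbTE lambda_neq0) (negbTE lambda_sub1) /=.
by rewrite subr_eq0 => /eqP ->; rewrite fineK //; exact: expected_discount_fin.
Unshelve. all: by end_near.
Qed.

(** The limit in [scaled_cars_cvg] vanishes, so [subcritical_bound] is uniform in [n] and passes to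
    the monotone limit. *)
Lemma fixed_point_finite_total : expected_discount = a%:E ->
  (\int[P]_w total_root_arrivals R (child ^~ w) (eta ^~ w) < +oo)%E.
Proof.
move=> fix_a; have c := scaled_cars_cvg.
rewrite /delta fix_a /= subrr mulr0 in c.
rewrite expected_total.
apply: (@le_lt_trans _ _ (lambda / (lambda - 1))%:E); last exact: ltry.
apply: lime_le; first exact: expected_cars_is_cvg.
by near=> n; rewrite xE lee_fin subcritical_bound.
Unshelve. all: by end_near.
Qed.

End limit.

(** * Survival of supercritical trees *)

Section truncated_generating_function.
Context (R : realType) (t : nat -> R).
Hypothesis t_ge0 : forall j, 0 <= t j.
Hypothesis t_noninc : forall j, t j.+1 <= t j.

(* If [t j = P (j < Z)], then by summation by parts this is the expectation of
   [e ^ min (Z, K)]. *)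
Definition truncated_pgf K (e : R) := 1 - (1 - e) * \sum_(j < K) t j * e ^+ j.

(** Summation by parts: without its last term [t k * e ^+ k], the function is a constant plus a
    polynomial with coefficients [t j - t j.+1 >= 0]. *)
Lemma truncated_pgf_mono K (e s : R) : 0 <= e -> e <= s ->
  truncated_pgf K e <= truncated_pgf K s.
Proof.
move=> e0 es.
have X k : e ^+ k <= s ^+ k by apply: lerXn2r; rewrite ?nnegrE // (le_trans e0).
suff h k : truncated_pgf k e - t k * e ^+ k <= truncated_pgf k s - t k * s ^+ k.
  by have := h K; have := ler_wpM2l (t_ge0 K) (X K); lra.
elim: k => [|k IHk].
  by rewrite /truncated_pgf !big_ord0 !expr0 !mulr0.
have step u : truncated_pgf k.+1 u - t k.+1 * u ^+ k.+1 =
   truncated_pgf k u - t k * u ^+ k + (t k - t k.+1) * u ^+ k.+1.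
  by rewrite /truncated_pgf big_ord_recr /= exprS; ring.
by rewrite !step lerD // ler_wpM2l // subr_ge0.
Qed.

(** With [s = 1 - u], the claim amounts to a lower bound 1 for the sum of [t j * s ^+ j]. It is
    enough that [s ^+ j >= M^-1] for all [j < K]. *)
Lemma truncated_pgf_le K : 1 < \sum_(j < K) t j ->
  exists2 s : R, 0 <= s < 1 & truncated_pgf K s <= s.
Proof.
set M := \sum_(j < K) t j => M1.
have K0 : (0 < K)%N by case: K @M M1 => // M; rewrite /M big_ord0 ltr10.
have M0 : 0 < M by exact: lt_trans ltr01 M1.
(* Chosen so that [1 - K * u = M^-1]; Bernoulli's inequality [bern] then bounds every power below by
   [M^-1]. *)
pose u := (1 - M^-1) / K%:R.
have Kr : 0 < K%:R :> R by rewrite ltr0n.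
have i1 : 0 < M^-1 < 1 by rewrite invr_gt0 M0 invf_lt1.
have u0 : 0 < u by rewrite divr_gt0 // subr_gt0; case/andP: i1.
have uK : u * K%:R = 1 - M^-1 by rewrite mulfVK // gt_eqF.
have u1 : u <= 1.
  rewrite ler_pdivrMr // mul1r.
  apply: le_trans (_ : 1 <= _); last by rewrite ler1n.
  by rewrite gerBl ltW //; case/andP: i1.
have s0 : 0 <= 1 - u by rewrite subr_ge0.
exists (1 - u); first by rewrite s0 gtrBl.
have bern k : 1 - k%:R * u <= (1 - u) ^+ k.
  elim: k => [|k IHk]; first by rewrite mul0r subr0 expr0.
  rewrite exprS -natr1; apply: le_trans (ler_wpM2l s0 IHk).
  have : 0 <= k%:R * u ^+ 2 by rewrite mulr_ge0 ?sqr_ge0.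
  by rewrite expr2; lra.
have low : 1 <= \sum_(j < K) t j * (1 - u) ^+ j.
  apply: (@le_trans _ _ (\sum_(j < K) t j * M^-1)).
    by rewrite -mulr_suml -/M divff // gt_eqF.
  apply: ler_sum => j _; apply: ler_wpM2l => //; apply: le_trans (bern j).
  have : j%:R * u <= K%:R * u.
    by rewrite ler_wpM2r ?(ltW u0) // ler_nat (ltnW (ltn_ord j)).
  by rewrite [K%:R * _]mulrC uK; lra.
rewrite /truncated_pgf lerBlDr -lerBlDl opprB addrCA subrr addr0.
by rewrite ler_peMr // ltW.
Qed.

End truncated_generating_function.

Section survival.
Context (R : realType) d (T : measurableType d) (P : probability T R).
Context (child eta : seq nat -> {RV P >-> nat}).
Context (offspring arrival : probability nat R) (lambda : R).
Hypothesis lambda_gt1 : 1 < lambda.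
Hypothesis model : is_parking_model offspring arrival child eta.
Hypothesis offspring_mean : mean offspring = lambda%:E.

Let field := field_at child eta.
Let dead n : set envT := [set f : envT | dies (f \o inl) n [::]].

Let e n := fine (P (field [::] @^-1` dead n)).
Let t j := fine (P (child [::] @^-1` [set z | (j < z)%N])).

Let dead_measurable n : measurable (dead n).
Proof. exact: dies_measurable. Qed.

Let fdead_measurable v n : measurable (field v @^-1` dead n).
Proof. exact: field_at_measurable_set. Qed.

Let eE n : P (field [::] @^-1` dead n) = (e n)%:E.
Proof. by rewrite fineK // fin_num_measure. Qed.

Let children_measurable j : measurable (child [::] @^-1` [set z | (j < z)%N]).
Proof. exact: measurable_nat_preimage. Qed.

Let tE j : P (child [::] @^-1` [set z | (j < z)%N]) = (t j)%:E.
Proof. by rewrite fineK // fin_num_measure. Qed.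

Let t_ge0 j : 0 <= t j. Proof. by rewrite -lee_fin -tE. Qed.

Let t_noninc j : t j.+1 <= t j.
Proof.
by rewrite -lee_fin -!tE le_measure ?inE // => w /=; exact: ltnW.
Qed.

Let e_bounds n : 0 <= e n <= 1.
Proof. by rewrite -!lee_fin -eE measure_ge0 probability_le1. Qed.

(** Only the first [K] potential children are examined, so finitely many subtrees are involved. *)
Let first_dead n K := [set w | forall i, (i < K)%N -> (i < child [::] w)%N ->
  dead n (field [:: i] w)].

Let first_dead_measurable n K : measurable (first_dead n K).
Proof.
rewrite (_ : first_dead n K = \bigcap_(i in [set i | (i < K)%N])
   (~` (child [::] @^-1` [set z | (i < z)%N]) `|` field [:: i] @^-1` dead n)).
  apply: fin_bigcap_measurable; first exact: finite_II.
  by move=> i _; apply: measurableU => //; apply: measurableC.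
apply/seteqP; split => w h i /= iK.
  have [/(h i iK)|ni] := boolP (i < child [::] w)%N; first by right.
  by left; apply/negP.
by move=> ic; have [/= /(_ ic)|] := h i iK.
Qed.

(** Each increment of [K] lowers the probability by [t K * e n ^+ K * (1 - e n)], which is the
    corresponding term of [truncated_pgf]. *)
Lemma first_dead_prob n K :
  P (first_dead n K) = (truncated_pgf t K (e n))%:E.
Proof.
elim: K => [|K IHK].
  rewrite /truncated_pgf big_ord0 mulr0 subr0 -(probability_setT P).
  congr (P _).
  by apply/seteqP; split.
have : (P (first_dead n K) = P (first_dead n K `\` first_dead n K.+1) +
    P (first_dead n K `&` first_dead n K.+1))%E by exact: measureDI.
rewrite (_ : first_dead n K `&` first_dead n K.+1 = first_dead n K.+1);
    last first.
  apply/seteqP; split => [w []|w h] //; split => // i iK.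
  by apply: h; exact: ltnW.
pose B i : set envT := if i == K then ~` dead n else dead n.
have mB i : measurable (B i).
  by rewrite /B; case: (i == K) => //; exact: measurableC.
(* The outcomes lost are those where child [K] exists and survives while all earlier children are
   dead. *)
have -> : first_dead n K `\` first_dead n K.+1 =
    [set w | [set z | (K < z)%N] (child [::] w) /\
             (forall i, (i < K.+1)%N -> B i (field [:: i] w))].
  apply/seteqP; split => [w [h]|w [Kz h]] /=.
    move=> /existsNP[i /not_implyP[iK /not_implyP[ic nd]]].
    have {iK} iK : i = K.
      apply/eqP; move: iK; rewrite ltnS leq_eqVlt => /predU1P[->//|iK].
      by case: nd; exact: h.
    rewrite {}iK in ic nd; split => // j; rewrite /B ltnS leq_eqVlt.
    case: eqP => [-> //|_ /= jK]; apply: h => //; exact: ltn_trans ic.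
  split => [i iK ic|/(_ K (ltnSn K) Kz)].
    by have := h i (ltnW iK); rewrite /B (ltn_eqF iK).
  by have := h K (ltnSn K); rewrite /B eqxx.
rewrite (root_block_independence model _ [set z | (K < z)%N] mB) tE.
rewrite big_ord_recr /= (eq_bigr (fun=> (e n)%:E)); last first.
  by move=> i _; rewrite /B ltn_eqF // eE.
have dC : P (field [::] @^-1` (~` dead n)) = (1 - e n)%:E.
  rewrite preimage_setC EFinB -eE.
  exact: (probability_setC P (fdead_measurable [::] n)).
rewrite /B eqxx dC IHK prodEFin prodr_const card_ord.
have f := fin_num_measure P _ (first_dead_measurable n K.+1).
rewrite -(fineK f) -!EFinM -EFinD => -[pK]; congr EFin.
by move: pK; rewrite /truncated_pgf big_ord_recr /=; lra.
Qed.

(** If no line reaches generation [n.+1], then in particular the first [K] children are dead after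
    [n] generations. *)
Lemma dead_step n K : e n.+1 <= truncated_pgf t K (e n).
Proof.
rewrite -lee_fin -eE -first_dead_prob; apply: le_measure; rewrite ?inE //.
move=> w /= /forallP h i iK ic.
exact: etrans (dies_cat (child ^~ w) [:: i] n [::]) (h (Ordinal ic)).
Qed.

(** The [t j] sum to [lambda > 1], so some partial sum exceeds 1 and [truncated_pgf_le] provides
    [s]. Starting from [e 0 = 0], monotonicity keeps every [e n] below [s]. *)
Lemma survival_positive : exists2 s : R, s < 1 & forall n, e n <= s.
Proof.
have [K K1] : exists K, 1 < \sum_(j < K) t j.
  apply: contrapT => /forallNP h.
  have : (\int[P]_w (child [::] w)%:R%:E <= 1%:E :> \bar R)%E.
    rewrite integral_nat_tail //.
    apply: lime_le; first exact: is_cvg_nneseries.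
    near=> K; rewrite big_mkord (eq_bigr (fun j : 'I_K => (t j)%:E)); last first.
      by move=> j _; rewrite -tE.
    by rewrite sumEFin lee_fin leNgt; apply/negP/h.
  rewrite (integral_child_eq1 model) offspring_mean lee_fin.
  by rewrite leNgt lambda_gt1.
have [s /andP[s0 s1] fs] := truncated_pgf_le t_ge0 K1.
exists s => // n; elim: n => [|n IHn].
  rewrite -lee_fin -eE (_ : _ @^-1` _ = set0) ?measure0 ?lee_fin //.
  by apply/seteqP; split.
apply: le_trans (dead_step n K) _; apply: le_trans fs.
by apply: truncated_pgf_mono => //; case/andP: (e_bounds n).
Unshelve. all: by end_near.
Qed.

(** Extinction is the increasing union of the [D n], so its probability is at most [s < 1]; almost
    sure extinction would make it 1. *)
Lemma non_extinct_not_negligible :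
  ~ {ae P, forall w, ~ non_extinct (child ^~ w)}.
Proof.
move=> ae.
have [s s1 es] := survival_positive.
pose D n := field [::] @^-1` dead n.
have ndD : nondecreasing_seq D.
  apply/nondecreasing_seqP => n; apply/subsetPset => w.
  exact: dies_leS.
have mU : measurable (\bigcup_n D n).
  by apply: bigcup_measurable => n _; exact: fdead_measurable.
have cvgD : P (D n) @[n --> \oo] --> P (\bigcup_n D n).
  by apply: nondecreasing_cvg_mu => // n; exact: fdead_measurable.
have Us : (P (\bigcup_n D n) <= s%:E)%E.
  rewrite -(cvg_lim _ cvgD) //; apply: lime_le; first exact: cvgP cvgD.
  by near=> n; rewrite /D eE lee_fin.
have U1 : P (~` \bigcup_n D n) = 0%E.
  apply/eqP; rewrite -measure_le0.
  case: ae => N [mN N0 sub].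
  rewrite -N0; apply: le_measure; rewrite ?inE //; first exact: measurableC.
  apply: subset_trans sub => w nD /=; apply; apply: survives_non_extinct => n.
  by apply/negP => dn; apply: nD; exists n.
have U := probability_setC P mU.
have f := fin_num_measure P _ mU.
move: U Us; rewrite U1 -(fineK f) -EFinB => -[]/esym/subr0_eq <-.
by rewrite lee_fin leNgt s1.
Unshelve. all: by end_near.
Qed.

End survival.

(** * A finite expected total forces extinction under the supercritical alternative *)

Section total.
Context (R : realType) d (T : measurableType d) (P : probability T R).
Context (child eta : seq nat -> {RV P >-> nat}).

Let total w := total_root_arrivals R (child ^~ w) (eta ^~ w).

Let total_cvg w : ((cars child eta n [::] w)%:R%:E : \bar R) @[n --> \oo]
  --> total w.
Proof.
rewrite /total /total_root_arrivals.
rewrite [X in limn X](_ : _ = fun n => (cars child eta n [::] w)%:R%:E);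
    last first.
  by apply/funext => n; rewrite /root_arrivals arrivalsE.
apply: ereal_nondecreasing_is_cvgn => m n mn.
by rewrite lee_fin ler_nat; exact: arrivals_mono.
Qed.

Lemma total_measurable : measurable_fun setT total.
Proof.
apply: (emeasurable_fun_cvg
  (fun n w => (cars child eta n [::] w)%:R%:E)) => [n|w _].
  by apply: natr_measurable; exact: cars_measurable.
exact: total_cvg.
Qed.

Lemma total_ge0 w : (0 <= total w)%E.
Proof.
rewrite -(cvg_lim _ (@total_cvg w)) //.
apply: lime_ge; first exact: cvgP (@total_cvg w).
by near=> n; rewrite lee_fin.
Unshelve. all: by end_near.
Qed.

(** An integrable total is almost surely finite, which contradicts the value [+oo] on survival. *)
Lemma finite_total_extinction : (\int[P]_w total w < +oo)%E ->
  {ae P, forall w, non_extinct (child ^~ w) -> total w = +oo%E} ->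
  {ae P, forall w, ~ non_extinct (child ^~ w)}.
Proof.
move=> fin inf.
have int : P.-integrable setT total.
  apply/integrableP; split; first exact: total_measurable.
  by under eq_integral do rewrite gee0_abs ?total_ge0 //.
have := integrable_ae measurableT int.
apply: filterS2 inf => w h1 h2 /h1 h3.
by have := h2 I; rewrite h3.
Qed.

End total.

Theorem proposition2 (R : realType) (lambda : R) (hlambda : 1 < lambda)
  (offspring : probability nat R) (hoffspring : mean offspring = lambda%:E)
  (J : interval R)
  (hJ0 : forall a : R, a \in J -> 0 <= a)
  (hJ1 : forall a : R, 0 < a < 1 -> a \in J)
  (arrival : R -> probability nat R)
  (hmean : forall a, a \in J -> mean (arrival a) = a%:E)
  (hmono : stochastically_increasing J arrival)
  (d : R -> measure_display) (T : forall a : R, measurableType (d a))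
  (P : forall a : R, probability (T a) R)
  (child eta : forall a : R, seq nat -> {RV (P a) >-> nat})
  (hmodel : forall a, a \in J ->
     is_parking_model offspring (arrival a) (child a) (eta a))
  (alpha_c : R) (hcrit : is_critical_threshold J child eta alpha_c) :
  (forall a, a \in J ->
     (('E_(P a)[fun w => (root_arrivals (child a ^~ w) (eta a ^~ w) n)%:R]
         * (lambda ^- n)%:E)%E @[n --> \oo]
      --> ((lambda / (lambda - 1))%:E *
           (a%:E - 'E_(P a)[fun w =>
              discount lambda (first_arrival R (child a ^~ w) (eta a ^~ w))]))%E))
  /\
  alpha_c = sup [set a | a \in J /\
    ('E_(P a)[fun w =>
        discount lambda (first_arrival R (child a ^~ w) (eta a ^~ w))]
     = a%:E)%E].
Proof.
split=> [a aJ|].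
  (* Both expectations are finite, so the limit in the extended reals reduces to the real one. *)
  have df := expected_discount_fin (child a) (eta a) hlambda.
  have xf n := expected_cars_fin (hmodel a aJ) hoffspring (hmean a aJ) n.
  have c := scaled_cars_cvg hlambda (hmodel a aJ) hoffspring (hmean a aJ).
  rewrite -[X in (a%:E - X)%E](fineK df) -EFinB -EFinM.
  have -> : (fun n =>
        'E_(P a)[fun w => (root_arrivals (child a ^~ w) (eta a ^~ w) n)%:R]
      * (lambda ^- n)%:E)%E =
      (fun n => (fine (expected_cars (child a) (eta a) n) * lambda ^- n)%:E).
    apply/funext => n; rewrite EFinM fineK // unlock; congr (_ * _)%E.
    by apply: eq_integral => w _; rewrite /root_arrivals /= arrivalsE.
  by apply: cvg_EFin => //; apply: nearW.
have [/andP[c0 c1] subcrit supercrit] := hcrit.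
set S := [set a | _].
have inS a : 0 < a < alpha_c -> S a.
  move=> /andP[a0 ac].
  have aJ : a \in J by apply: hJ1; rewrite a0 (lt_trans ac).
  split => //.
  exact: (finite_total_fixed_point hlambda (hmodel a aJ) hoffspring
    (hmean a aJ) (subcrit a aJ ac)).
(* A fixed point above [alpha_c] would give a finite [E X], hence almost sure extinction, although
   survival has positive probability. *)
have ubS : ubound S alpha_c.
  move=> a [aJ fix_a]; rewrite leNgt; apply/negP => ac.
  have fin := fixed_point_finite_total hlambda (hmodel a aJ) hoffspring
    (hmean a aJ) fix_a.
  apply: (non_extinct_not_negligible hlambda (hmodel a aJ) hoffspring).
  exact: finite_total_extinction fin (supercrit a aJ ac).
have S0 : S !=set0 by exists (alpha_c / 2); apply: inS; lra.
apply/eqP; rewrite eq_le; apply/andP; split; last exact: ge_sup.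
(* Otherwise the midpoint of [sup S] and [alpha_c] would lie in [S] above its supremum; [s0] ensures
   that this midpoint is positive, as [inS] requires. *)
rewrite leNgt; apply/negP => lt_c.
have s0 : 0 < sup S.
  apply: (@lt_le_trans _ _ (alpha_c / 2)); first by lra.
  by apply: ub_le_sup; [exists alpha_c|apply: inS; lra].
have : (sup S + alpha_c) / 2 <= sup S.
  by apply: ub_le_sup; [exists alpha_c|apply: inS; lra].
lra.
Qed.
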